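(* Let $n\ge2$ and let $X=(u,\gamma+s)$, $Y=(v,\delta+t)$ belong to $V_n$, where $u,v,s,t\in V_{n-1}$ and $\gamma,\delta\in\mathbb R$. Let $$Z:=\mathsf C_{n-1}(u+\iota s,v+\iota t).$$ Then $$X\times_nY=\bigl(\operatorname{Re}_{\mathrm c}Z+\gamma t-\delta s,\;\;\lambda+\delta u-\gamma v-\operatorname{Im}_{\mathrm c}Z\bigr),$$ where $\lambda:=\langle s,v\rangle-\langle t,u\rangle$ and $\operatorname{Re}_{\mathrm c},\operatorname{Im}_{\mathrm c}$ denote coefficientwise real and imaginary parts.
   Context: **Cayley--Dickson tower.** $A_0:=\mathbb R$ with $\bar r=r$. Recursively $A_n:=A_{n-1}\oplus A_{n-1}$ with $$\overline{(a,b)}=(\bar a,-b),\qquad (a,b)(c,d)=\bigl(ac-\bar d\,b,\;da+b\bar c\bigr).$$ The standard (recursive, concatenated) basis identifies $A_n$ with $\mathbb R^{2^n}$ and gives its Euclidean inner product $\langle\cdot,\cdot\rangle$. Scalars are identified with multiples of the unit. Put $V_n:=\{x\in A_n:\bar x=-x\}$, and for $u,v\in V_n$ define $u\times_n v:=\frac12(uv-vu)$, which lies in $V_n$. For $n\ge2$ every element of $V_n\subset A_{n-1}\oplus A_{n-1}$ is uniquely $(u,\gamma+s)$ with $u,s\in V_{n-1}$ and $\gamma\in\mathbb R$. **Scalar extension.** $V_n^{\mathbb C}:=V_n\otimes_{\mathbb R}\mathbb C$, with $\iota$ the central coefficient satisfying $\iota^2=-1$. $\mathsf C_n:V_n^{\mathbb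 C}\times V_n^{\mathbb C}\to V_n^{\mathbb C}$ denotes the complex-bilinear extension of $\times_n$. Coefficientwise real and imaginary parts of an element $Z=D+\iota H\in V_n^{\mathbb C}$ with $D,H\in V_n$ are $\operatorname{Re}_{\mathrm c}Z=D$, $\operatorname{Im}_{\mathrm c}Z=H$. *)

(* Defs.v *)
From HB Require Import structures.
From mathcomp Require Import all_boot all_order all_algebra.
From mathcomp Require Import sesquilinear complex reals.

Set Implicit Arguments.
Unset Strict Implicit.
Unset Printing Implicit Defensive.

Import Order.TTheory GRing.Theory Num.Theory.
Local Open Scope ring_scope.

Section CayleyDickson.
Variable R : realType.

Fixpoint cd (n : nat) : vectType R :=
  if n is m.+1 then (cd m * cd m)%type else R^o.

Definition cdpair n (a b : cd n) : cd n.+1 := (a, b).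

Fixpoint cdone n : cd n :=
  match n return cd n with
  | 0 => (1 : R)
  | m.+1 => cdpair (cdone m) 0
  end.

Definition cdscal n (r : R) : cd n := r *: cdone n.

Fixpoint cdconj n : cd n -> cd n :=
  match n return cd n -> cd n with
  | 0 => id
  | m.+1 => fun x : cd m * cd m => cdpair (cdconj x.1) (- x.2)
  end.

Fixpoint cdmul n : cd n -> cd n -> cd n :=
  match n return cd n -> cd n -> cd n with
  | 0 => fun x y : R => x * y
  | m.+1 => fun x y : cd m * cd m =>
      cdpair (cdmul x.1 y.1 - cdmul (cdconj y.2) x.2)
             (cdmul y.2 x.1 + cdmul x.2 (cdconj y.1))
  end.

Fixpoint cdbasis_seq n : seq (cd n) :=
  match n return seq (cd n) with
  | 0 => [:: (1 : R^o)]
  | m.+1 => [seq cdpair e 0 | e <- cdbasis_seq m]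
              ++ [seq cdpair 0 e | e <- cdbasis_seq m]
  end.

Lemma size_cdbasis n : size (cdbasis_seq n) == (2 ^ n)%N.
Proof.
elim: n => // n /eqP IHn.
by rewrite size_cat !size_map IHn addnn -mul2n -expnS.
Qed.

Definition cdbasis n : (2 ^ n).-tuple (cd n) := Tuple (size_cdbasis n).

Definition cdcoord n (x : cd n) : 'rV[R]_(2 ^ n) :=
  \row_i coord (cdbasis n) i x.

Definition cdinner n (x y : cd n) : R :=
  \sum_(i < 2 ^ n) cdcoord x 0 i * cdcoord y 0 i.

Lemma dim_cd n : \dim (fullv : {vspace cd n}) = (2 ^ n)%N.
Proof.
rewrite dimvf; elim: n => // n IHn.
by rewrite expnS mul2n -addnn -[in RHS]IHn.
Qed.

Lemma cdbasis_span n (x : cd n) : x \in <<cdbasis n>>%VS.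
Proof.
rewrite /cdbasis /=; elim: n x => [x|n IHn x].
  rewrite span_seq1; apply/vlineP; exists (x : R).
  by rewrite /GRing.scale /= mulr1.
have mapl (f : {linear cd n -> cd n.+1}) a :
    f a \in <<[seq f e | e <- cdbasis_seq n]>>%VS.
  have -> : [seq f e | e <- cdbasis_seq n] = map (linfun f) (cdbasis_seq n).
    by apply: eq_map => e; rewrite lfunE.
  by rewrite -limg_span -(lfunE f) memv_img ?IHn.
have linl : linear (fun a : cd n => cdpair a 0).
  by move=> k a b; congr pair; rewrite /= scaler0 addr0.
have linr : linear (fun a : cd n => cdpair 0 a).
  by move=> k a b; congr pair; rewrite /= scaler0 addr0.
pose Ll := GRing.isLinear.Build R (cd n) (cd n.+1) _ _ linl.
pose Lr := GRing.isLinear.Build R (cd n) (cd n.+1) _ _ linr.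
pose fl : {linear cd n -> cd n.+1} := HB.pack (fun a : cd n => cdpair a 0) Ll.
pose fr : {linear cd n -> cd n.+1} := HB.pack (fun a : cd n => cdpair 0 a) Lr.
have -> : x = fl x.1 + fr x.2.
  by case: x => a b; congr pair; rewrite /= ?addr0 ?add0r.
by rewrite span_cat memv_add.
Qed.

Lemma cdbasis_basis n : basis_of fullv (cdbasis n).
Proof.
rewrite basisEdim dim_cd size_tuple leqnn andbT.
by apply/subvP => x _; exact: cdbasis_span.
Qed.

Lemma cdpairP n (x : cd n.+1) : exists a b, x = cdpair a b.
Proof. by case: x => a b; exists a, b. Qed.

Lemma cdpairD n (a b c d : cd n) :
  cdpair a b + cdpair c d = cdpair (a + c) (b + d).
Proof. by []. Qed.

Lemma cdpairN n (a b : cd n) : - cdpair a b = cdpair (- a) (- b).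
Proof. by []. Qed.

Lemma cdpairZ n k (a b : cd n) : k *: cdpair a b = cdpair (k *: a) (k *: b).
Proof. by []. Qed.

Lemma cdconj_pair n (a b : cd n) :
  cdconj (cdpair a b) = cdpair (cdconj a) (- b).
Proof. by []. Qed.

Lemma cdmul_pair n (a b c d : cd n) :
  cdmul (cdpair a b) (cdpair c d) =
  cdpair (cdmul a c - cdmul (cdconj d) b) (cdmul d a + cdmul b (cdconj c)).
Proof. by []. Qed.

Lemma cdconj_linear n : linear (@cdconj n).
Proof.
elim: n => [//|n IHn] k x y.
have [a [b ->]] := cdpairP x; have [c [d ->]] := cdpairP y.
rewrite !(cdpairZ, cdpairD, cdconj_pair) IHn.
by rewrite opprD scalerN.
Qed.

HB.instance Definition _ n :=
  GRing.isLinear.Build R (cd n) (cd n) _ (@cdconj n) (@cdconj_linear n).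

Lemma cdmul_bilinear n : bilinear_for *:%R *:%R (@cdmul n).
Proof.
elim: n => [|n [IHl IHr]].
  split=> z k x y; rewrite /= /GRing.scale /=.
    by rewrite mulrDl mulrA.
  by rewrite mulrDr !mulrA [z * k]mulrC.
have Dl (z x y : cd n) k : cdmul (k *: x + y) z = k *: cdmul x z + cdmul y z.
  exact: IHl.
have Dr (z x y : cd n) k : cdmul z (k *: x + y) = k *: cdmul z x + cdmul z y.
  exact: IHr.
split=> z k x y; have [z1 [z2 ->]] := cdpairP z;
  have [a [b ->]] := cdpairP x; have [c [d ->]] := cdpairP y.
  rewrite !(cdpairZ, cdpairD, cdmul_pair) !Dl !Dr.
  by rewrite opprD !scalerDr scalerN addrACA [X in cdpair _ X]addrACA.
rewrite !(cdpairZ, cdpairD, cdmul_pair) !linearP !Dl !Dr.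
by rewrite opprD !scalerDr scalerN addrACA [X in cdpair _ X]addrACA.
Qed.

HB.instance Definition _ n := bilinear_isBilinear.Build R (cd n) (cd n) (cd n)
  *:%R *:%R (@cdmul n) (cdmul_bilinear n).

Lemma cdconjK n : involutive (@cdconj n).
Proof.
elim: n => [//|n IHn] x; have [a [b ->]] := cdpairP x.
by rewrite !cdconj_pair IHn opprK.
Qed.

Lemma cdconjM n (x y : cd n) :
  cdconj (cdmul x y) = cdmul (cdconj y) (cdconj x).
Proof.
elim: n x y => [|n IHn] x y; first exact: mulrC.
have [a [b ->]] := cdpairP x; have [c [d ->]] := cdpairP y.
rewrite !(cdmul_pair, cdconj_pair) linearB /= !IHn !cdconjK.
by rewrite linearN linearNl linearNr !linearNl opprK opprD addrC [X in _ = cdpair _ X]addrC.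
Qed.

Definition imag_pred n : {pred cd n} := [pred x | cdconj x == - x].

Lemma imag_submod_closed n : submod_closed (@imag_pred n).
Proof.
split=> [|k x y]; first by rewrite inE linear0 oppr0.
rewrite !inE => /eqP xI /eqP yI.
by rewrite linearP /= xI yI scalerN opprD.
Qed.

HB.instance Definition _ n :=
  GRing.isSubmodClosed.Build R (cd n) (@imag_pred n) (@imag_submod_closed n).

Record imag n := Imag { imag_val :> cd n; _ : imag_val \in @imag_pred n }.

HB.instance Definition _ n := [isSub for @imag_val n].
HB.instance Definition _ n := [Choice of imag n by <:].
HB.instance Definition _ n := [SubChoice_isSubLmodule of imag n by <:].

Lemma imagE n (u : imag n) : cdconj (u : cd n) = - (u : cd n).
Proof. by apply/eqP; case: u. Qed.

Lemma cross_subproof n (u v : imag n) :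
  2^-1 *: (cdmul (u : cd n) v - cdmul (v : cd n) u) \in @imag_pred n.
Proof.
rewrite inE linearZ /= linearB /= !cdconjM !imagE.
by rewrite !linearNl !linearNr !opprK -scalerN opprB.
Qed.

Definition cross n (u v : imag n) : imag n := Imag (cross_subproof u v).

Lemma cross_bilinear n :
  bilinear_for *:%R *:%R (@cross n).
Proof.
split=> z k x y; apply: val_inj => /=.
  rewrite linearPl linearPr /= !scalerA ![k * _]mulrC -!scalerA -!scalerDr.
  by congr (_ *: _); rewrite scalerBr opprD addrACA.
rewrite linearPl linearPr /= !scalerA ![k * _]mulrC -!scalerA -!scalerDr.
by congr (_ *: _); rewrite scalerBr opprD addrACA.
Qed.

HB.instance Definition _ n :=
  bilinear_isBilinear.Build R (imag n) (imag n) (imag n)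
    *:%R *:%R (@cross n) (cross_bilinear n).

End CayleyDickson.

(* The scalar extension of W along R -> R[i] is presented by its elements     *)
(* Rec + iota Imc, with R[i] acting on it; the central coefficient iota is    *)
(* the scalar 'i%C.                                                           *)
Record cplxn (W : Type) := Cplxn { Rec : W; Imc : W }.

Definition pair_of_cplxn W (Z : cplxn W) := (Rec Z, Imc Z).
Definition cplxn_of_pair W (p : W * W) := Cplxn p.1 p.2.

Lemma pair_of_cplxnK W : cancel (@pair_of_cplxn W) (@cplxn_of_pair W).
Proof. by case. Qed.

HB.instance Definition _ (W : choiceType) :=
  Choice.copy (cplxn W) (can_type (@pair_of_cplxnK W)).

Section Complexification.
Variables (R : realType) (W : lmodType R).
Implicit Types (Z T : cplxn W) (a b : R[i]).

Definition cplxn_add Z T := Cplxn (Rec Z + Rec T) (Imc Z + Imc T).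
Definition cplxn_opp Z := Cplxn (- Rec Z) (- Imc Z).

Lemma cplxn_addA : associative cplxn_add.
Proof. by move=> Z T U; rewrite /cplxn_add /= !addrA. Qed.
Lemma cplxn_addC : commutative cplxn_add.
Proof. by move=> Z T; congr Cplxn; rewrite addrC. Qed.
Lemma cplxn_add0 : left_id (Cplxn 0 0) cplxn_add.
Proof. by case=> D H; rewrite /cplxn_add /= !add0r. Qed.
Lemma cplxn_addN : left_inverse (Cplxn 0 0) cplxn_opp cplxn_add.
Proof. by case=> D H; rewrite /cplxn_add /= !addNr. Qed.

HB.instance Definition _ := GRing.isZmodule.Build (cplxn W)
  cplxn_addA cplxn_addC cplxn_add0 cplxn_addN.

Definition cplxn_scale a Z :=
  Cplxn (complex.Re a *: Rec Z - complex.Im a *: Imc Z)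
        (complex.Re a *: Imc Z + complex.Im a *: Rec Z).

Lemma cplxn_scaleA a b Z :
  cplxn_scale a (cplxn_scale b Z) = cplxn_scale (a * b) Z.
Proof.
case: a b Z => [a1 a2] [b1 b2] [D H]; congr Cplxn => /=.
  rewrite !scalerBr !scalerDr !scalerBl !scalerDl !scalerA !opprD -!addrA.
  by congr (_ + _); rewrite [RHS]addrC -!addrA.
rewrite !scalerBr !scalerDr !scalerBl !scalerDl !scalerA -!addrA.
by congr (_ + _); rewrite [RHS]addrC -!addrA.
Qed.
Lemma cplxn_scale1 : left_id 1 cplxn_scale.
Proof.
by case=> D H; rewrite /cplxn_scale /= !scale1r !scale0r subr0 addr0.
Qed.
Lemma cplxn_scaleDr : right_distributive cplxn_scale +%R.
Proof.
move=> [a1 a2] [D H] [D' H']; congr Cplxn => /=.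
  by rewrite !scalerDr opprD addrACA.
by rewrite !scalerDr addrACA.
Qed.
Lemma cplxn_scaleDl Z : {morph cplxn_scale^~ Z : a b / a + b}.
Proof.
move: Z => [D H] [a1 a2] [b1 b2]; congr Cplxn => /=.
  by rewrite !scalerDl opprD addrACA.
by rewrite !scalerDl addrACA.
Qed.

HB.instance Definition _ := GRing.Zmodule_isLmodule.Build R[i] (cplxn W)
  cplxn_scaleA cplxn_scale1 cplxn_scaleDr cplxn_scaleDl.

Definition cplxn_in (w : W) : cplxn W := Cplxn w 0.

Lemma cplxnE Z : Z = cplxn_in (Rec Z) + 'i%C *: cplxn_in (Imc Z).
Proof.
case: Z => D H; congr Cplxn => /=.
  by rewrite scale0r scaler0 subr0 addr0.
by rewrite scale0r scale1r !add0r.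
Qed.

End Complexification.

Section BilinearExtension.
Variables (R : realType) (W : lmodType R) (B : {bilinear W -> W -> W}).

Definition cplxn_ext (Z T : cplxn W) : cplxn W :=
  Cplxn (B (Rec Z) (Rec T) - B (Imc Z) (Imc T))
        (B (Rec Z) (Imc T) + B (Imc Z) (Rec T)).

(* cplxn_ext B is the unique R[i]-bilinear map extending B. *)
Lemma cplxn_ext_bilinear :
  bilinear_for *:%R *:%R cplxn_ext.
Proof.
split=> T a X Y; congr Cplxn => /=;
  rewrite !(linearDl, linearDr, linearNl, linearNr, linearZl_LR, linearZr_LR) /=
    !(scalerDr, scalerBr, scalerN, opprD).
- by rewrite [LHS](AC (3*3) ((1*4)*(5*2)*(3*6)))%AC.
- by rewrite [LHS](AC (3*3) ((1*4)*(5*2)*(3*6)))%AC.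
- by rewrite [LHS](AC (3*3) ((1*4)*(2*5)*(3*6)))%AC.
- by rewrite [LHS](AC (3*3) ((1*4)*(2*5)*(3*6)))%AC.
Qed.

HB.instance Definition _ :=
  bilinear_isBilinear.Build R[i] (cplxn W) (cplxn W) (cplxn W)
    *:%R *:%R cplxn_ext cplxn_ext_bilinear.

Lemma cplxn_ext_in u v :
  cplxn_ext (cplxn_in u) (cplxn_in v) = cplxn_in (B u v).
Proof.
by congr Cplxn; rewrite /= ?linear0l ?linear0r ?subr0 ?addr0.
Qed.

Lemma cplxn_ext_unique (C : {bilinear cplxn W -> cplxn W -> cplxn W}) :
  (forall u v, C (cplxn_in u) (cplxn_in v) = cplxn_in (B u v)) ->
  forall Z T, C Z T = cplxn_ext Z T.
Proof.
move=> CB Z T; rewrite [Z]cplxnE [T]cplxnE.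
by rewrite !(linearDl, linearDr, linearZl_LR, linearZr_LR) /= !CB !cplxn_ext_in.
Qed.

End BilinearExtension.

Definition ccross (R : realType) n (Z T : cplxn (imag R n)) :=
  cplxn_ext (@cross R n) Z T.

(* Main.v *)
Require Import Defs.
From mathcomp Require Import all_boot all_order all_algebra.
From mathcomp Require Import sesquilinear complex reals.

(** The doubling formula turns the product of [X = (u, gamma + s)] and
    [Y = (v, delta + t)] into products one level down, and conjugation acts
    on [u], [s], [v], [t] as a sign.  Antisymmetrizing in [X] and [Y], the
    first component becomes [u x v - s x t + gamma t - delta s], the real part
    of the complexified cross product corrected by scalars.  The
    second component of [XY] is [delta u - gamma v + tu - sv], which already
    changes sign when [X] and [Y] are exchanged: there antisymmetrizing leaves
    the whole products [tu] and [sv], not only their antisymmetric parts.  A product of imaginary elements is its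
    cross product minus its inner product ([cdmul_imag]); this produces
    [lambda] and, by antisymmetry of the cross product, minus the imaginary
    part of the complexified one.

    The only fact which is not formal is thus the link between the product and
    the Euclidean inner product: [x conj(y) + y conj(x) = 2 <x, y>]
    ([cdmul_conj_sym]).  It is bilinear, so it is enough to check it on the
    standard basis, where it follows by induction along the doubling
    ([cdbasis_orthonormal]). *)

Set Implicit Arguments.
Unset Strict Implicit.
Unset Printing Implicit Defensive.

Import GRing.Theory.
Local Open Scope ring_scope.

Section CayleyDicksonProduct.
Variable R : realType.

Lemma cdconj1 n : cdconj (cdone R n) = cdone R n.
Proof. by elim: n => // n IHn; rewrite cdconj_pair IHn oppr0. Qed.

Lemma cdmul1_both n (x : cd R n) :
  cdmul (cdone R n) x = x /\ cdmul x (cdone R n) = x.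
Proof.
elim: n x => [|n IHn] x; first by split; [exact: mul1r | exact: mulr1].
have [a [b ->]] := cdpairP x.
have [a1 a2] := IHn a; have [b1 b2] := IHn b.
rewrite !cdmul_pair cdconj1 !linear0 /= !linear0l !linear0r a1 a2 b2.
by rewrite !subr0 addr0 add0r.
Qed.

Lemma cdmul1x n (x : cd R n) : cdmul (cdone R n) x = x.
Proof. by case: (cdmul1_both x). Qed.

Lemma cdmulx1 n (x : cd R n) : cdmul x (cdone R n) = x.
Proof. by case: (cdmul1_both x). Qed.

Lemma cdmul_scall n k (x : cd R n) : cdmul (cdscal n k) x = k *: x.
Proof. by rewrite /cdscal linearZl_LR /= cdmul1x. Qed.

Lemma cdmul_scalr n k (x : cd R n) : cdmul x (cdscal n k) = k *: x.
Proof. by rewrite /cdscal linearZr_LR /= cdmulx1. Qed.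

Lemma cdconj_scal n k : cdconj (cdscal n k : cd R n) = cdscal n k.
Proof. by rewrite /cdscal linearZ /= cdconj1. Qed.

(** Polarization of the quadratic form [2 x conj(x)]. *)
Definition cdsym n (x y : cd R n) := cdmul x (cdconj y) + cdmul y (cdconj x).

(** The second components of the two products cancel, so doubling adds up the
    symmetrized products of the halves, with conjugates on the second one. *)
Lemma cdsym_pair n (a b c d : cd R n) :
  cdsym (cdpair a b) (cdpair c d) =
  cdpair (cdsym a c + cdsym (cdconj b) (cdconj d)) 0.
Proof.
rewrite /cdsym !cdconj_pair !cdmul_pair !cdconjK !linearN /= !linearNl /= !opprK.
rewrite cdpairD; congr cdpair.
  by rewrite addrACA [cdmul (cdconj d) _ + _]addrC.
by rewrite addrA addrK addNr.
Qed.

(** Doubling splits the basis into [(e, 0)] and [(0, e)]; by [cdsym_pair] two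
    vectors from different halves are orthogonal, and two from the same half
    reduce to the previous level.  The second half reduces to conjugates of
    basis vectors, which is why the induction carries the statement for these
    as well. *)
Lemma cdbasis_orthonormal n (i j : nat) :
    (i < 2 ^ n)%N -> (j < 2 ^ n)%N ->
  let e k := nth 0 (cdbasis_seq R n) k in
  cdsym (e i) (e j) = cdscal n (i == j)%:R *+ 2 /\
  cdsym (cdconj (e i)) (cdconj (e j)) = cdscal n (i == j)%:R *+ 2.
Proof.
elim: n i j => [|n IHn] i j.
  case: i j => [|//] [|//] _ _ /=.
  have E : cdsym (n := 0) (1 : R^o) (1 : R^o) = cdscal 0 (1 : R) *+ 2.
    rewrite /cdsym /cdscal /= mulr2n.
    by congr (_ + _); rewrite /GRing.scale /= mulr1.
  by split; exact: E.
have sz : size (cdbasis_seq R n) = (2 ^ n)%N := eqP (size_cdbasis R n).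
have cdsym00l (x : cd R n) : cdsym 0 x = 0.
  by rewrite /cdsym linear0l linear0 linear0r addr0.
have cdsym00r (x : cd R n) : cdsym x 0 = 0.
  by rewrite /cdsym linear0 linear0l linear0r addr0.
have nthE k : (k < 2 ^ n.+1)%N -> nth 0 (cdbasis_seq R n.+1) k =
    if (k < 2 ^ n)%N then cdpair (nth 0 (cdbasis_seq R n) k) 0
    else cdpair 0 (nth 0 (cdbasis_seq R n) (k - 2 ^ n)).
  move=> kn; rewrite /= nth_cat size_map sz.
  case: ltnP => kn'; rewrite (nth_map 0) ?sz //.
  by rewrite ltn_subLR // addnn -mul2n -expnS.
have pairM k : cdpair (cdscal n (k : R) *+ 2) 0 = cdscal n.+1 k *+ 2.
  by rewrite !mulr2n /cdscal /= cdpairZ cdpairD !scaler0 addr0.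
move=> ilt jlt e; rewrite /e !nthE //.
have sublt k : (k < 2 ^ n.+1)%N -> (2 ^ n <= k)%N -> (k - 2 ^ n < 2 ^ n)%N.
  by move=> k1 k2; rewrite ltn_subLR // addnn -mul2n -expnS.
have scal0 m : cdscal m (0 : R) = 0 by rewrite /cdscal scale0r.
case: (ltnP i) => ib; case: (ltnP j) => jb;
  rewrite !cdconj_pair !cdsym_pair ?linearN ?linear0 /= ?oppr0.
- rewrite !cdsym00l !addr0; have [-> ->] := IHn i j ib jb.
  by rewrite pairM.
- rewrite !(cdsym00l, cdsym00r) addr0 ltn_eqF ?(leq_trans ib) //.
  by rewrite scal0 mul0rn.
- rewrite !(cdsym00l, cdsym00r) addr0 gtn_eqF ?(leq_trans jb) //.
  by rewrite scal0 mul0rn.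
have symNN (x y : cd R n) : cdsym (- x) (- y) = cdsym x y.
  by rewrite /cdsym !linearN /= !linearNr !linearNl !opprK.
rewrite !symNN !cdsym00l !add0r.
have [_ ->] := IHn _ _ (sublt i ilt ib) (sublt j jlt jb).
by rewrite pairM -(eqn_add2r (2 ^ n)) !subnK.
Qed.

(** Expanding both arguments in the standard basis, only the diagonal terms
    survive, and they are those of the coordinatewise inner product. *)
Lemma cdmul_conj_sym n (x y : cd R n) :
  cdmul x (cdconj y) + cdmul y (cdconj x) = cdscal n (cdinner x y) *+ 2.
Proof.
have Ex (z : cd R n) :
    z = \sum_i cdcoord z 0 i *: (cdbasis R n)`_i.
  rewrite {1}(coord_basis (cdbasis_basis R n) (memvf z)).
  by apply: eq_bigr => i _; rewrite mxE.
have sumE (z w : cd R n) : cdmul z (cdconj w) =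
    \sum_i \sum_j (cdcoord z 0 i * cdcoord w 0 j) *:
      cdmul (cdbasis R n)`_i (cdconj (cdbasis R n)`_j).
  rewrite {1}[z]Ex linear_sumlz /=; apply: eq_bigr => i _.
  rewrite {1}[w]Ex linear_sum /= linear_sumr /=; apply: eq_bigr => j _.
  by rewrite linearZl_LR /= linearZ /= linearZr_LR /= scalerA.
rewrite (sumE x y) (sumE y x) [X in _ + X]exchange_big -big_split /=.
rewrite /cdscal /cdinner scaler_suml -sumrMnl; apply: eq_bigr => i _.
rewrite -big_split (bigD1 i) //= big1 => [|j ji].
  rewrite addr0 [cdcoord y 0 i * _]mulrC -scalerDr.
  have [E _] := cdbasis_orthonormal (ltn_ord i) (ltn_ord i).
  by move: E; rewrite /cdsym eqxx /cdscal scale1r => ->; rewrite scalerMnr.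
rewrite [cdcoord y 0 j * _]mulrC -scalerDr.
have [E _] := cdbasis_orthonormal (ltn_ord i) (ltn_ord j).
move: E; rewrite /cdsym => ->.
rewrite (_ : (i == j :> nat) = false); last by rewrite val_eqE eq_sym (negbTE ji).
by rewrite /cdscal scale0r mul0rn scaler0.
Qed.

(** On imaginary elements conjugation is a sign, so the symmetric part of the
    product is minus the inner product; the antisymmetric part is the cross
    product. *)
Lemma cdmul_imag n (x y : imag R n) :
  cdmul (x : cd R n) y = (cross x y : cd R n) - cdscal n (cdinner (x : cd R n) y).
Proof.
have := cdmul_conj_sym (x : cd R n) y.
rewrite !imagE !linearNr -opprD => /= E.
have n2 : 2 != 0 :> R by rewrite Num.Theory.pnatr_eq0.
apply: (scalerI n2); rewrite scalerBr /= scalerA mulfV // scale1r.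
by rewrite [X in _ - X]scaler_nat -E opprK [X in _ + X]addrC addrA subrK scaler_nat mulr2n.
Qed.

Lemma cross_double n (x y : imag R n) :
  (cross x y : cd R n) + (cross x y : cd R n) = cdmul (x : cd R n) y - cdmul (y : cd R n) x.
Proof.
by rewrite -mulr2n -scaler_nat /= scalerA mulfV ?scale1r // Num.Theory.pnatr_eq0.
Qed.

Lemma cross_anti n (x y : imag R n) : cross x y = - cross y x.
Proof. by apply: val_inj; rewrite /= -scalerN opprB. Qed.

(** The terms are grouped by their behaviour when the factors, that is
    [(u, s, gamma)] and [(v, t, delta)], are exchanged: in the first component
    the middle group changes sign and the constant [gamma * delta] does not,
    while the second component changes sign as a whole. *)
Lemma cdmul_imag_pair n (u v s t : imag R n) (gamma delta : R) :
  cdmul (cdpair (u : cd R n) (cdscal n gamma + (s : cd R n)))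
        (cdpair (v : cd R n) (cdscal n delta + (t : cd R n))) =
  cdpair (cdmul (u : cd R n) v + (gamma *: (t : cd R n) - delta *: (s : cd R n))
            + (cdmul (t : cd R n) s - cdscal n (gamma * delta)))
         ((delta *: (u : cd R n) - gamma *: (v : cd R n))
            + (cdmul (t : cd R n) u - cdmul (s : cd R n) v)).
Proof.
rewrite cdmul_pair [cdconj (_ + _)]linearD /= cdconj_scal !imagE.
rewrite [cdmul (_ - _) _]linearBl /= [cdmul (cdscal _ _) _]linearDr /=.
rewrite [cdmul (imag_val t) (_ + _)]linearDr /=.
rewrite [cdmul (_ + _) (imag_val u)]linearDl /=.
rewrite [cdmul (_ + _) (- _)]linearDl /= !linearNr /=.
rewrite !cdmul_scall !cdmul_scalr {1}/cdscal scalerA [delta * _]mulrC -/(cdscal n _).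
congr cdpair.
  rewrite !opprD !opprK -!addrA; congr (_ + _).
  by rewrite addrC -!addrA addrCA.
by rewrite addrACA.
Qed.

End CayleyDicksonProduct.

Theorem corollary3p4 (R : realType) (n : nat) (hn : (2 <= n.+1)%N)
    (X Y : imag R n.+1) (u v s t : imag R n) (gamma delta : R)
    (hX : (X : cd R n.+1) = cdpair u (cdscal n gamma + (s : cd R n)))
    (hY : (Y : cd R n.+1) = cdpair v (cdscal n delta + (t : cd R n))) :
  let Z : cplxn (imag R n) :=
    ccross (cplxn_in u + 'i%C *: cplxn_in s) (cplxn_in v + 'i%C *: cplxn_in t) in
  let lambda : R := cdinner (s : cd R n) v - cdinner (t : cd R n) u in
  (cross X Y : cd R n.+1) =
    cdpair ((Rec Z + gamma *: t - delta *: s : imag R n) : cd R n)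
           (cdscal n lambda
              + ((delta *: u - gamma *: v - Imc Z : imag R n) : cd R n)).
Proof.
move=> Z lambda.
have ZE : Z = Cplxn (cross u v - cross s t) (cross u t + cross s v).
  by rewrite /Z -(cplxnE (Cplxn u s)) -(cplxnE (Cplxn v t)).
pose K : cd R n := gamma *: (t : cd R n) - delta *: (s : cd R n).
pose L : cd R n := delta *: (u : cd R n) - gamma *: (v : cd R n).
have ReE : ((Rec Z + gamma *: t - delta *: s : imag R n) : cd R n) =
    (cross u v : cd R n) - (cross s t : cd R n) + K.
  by rewrite -addrA ZE.
have ImE : ((delta *: u - gamma *: v - Imc Z : imag R n) : cd R n) =
    L - ((cross u t : cd R n) + (cross s v : cd R n)).
  by rewrite ZE.
have half (V : lmodType R) (a b : V) : a = b + b -> 2^-1 *: a = b.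
  move=> ->; rewrite -mulr2n -scaler_nat scalerA mulVf ?scale1r //.
  by rewrite Num.Theory.pnatr_eq0.
have -> : (cross X Y : cd R n.+1) =
  2^-1 *: (cdmul (X : cd R n.+1) Y - cdmul (Y : cd R n.+1) X) by [].
rewrite ReE ImE hX hY !cdmul_imag_pair cdpairN cdpairD cdpairZ.
rewrite -(opprB (gamma *: (t : cd R n))) -/K -(opprB (delta *: (u : cd R n))) -/L.
rewrite [delta * _]mulrC.
(* From here on only the additive group structure matters; half undoes the
   factor 1/2 of the cross product. *)
clearbody K L; congr cdpair; apply: half.
  set m := cdscal n _.
  (* Under the exchange K changes sign, hence doubles, and m cancels. *)
  rewrite [RHS]addrACA [X in _ = X + _]addrACA -[X in _ = _ + X + _]opprD.
  rewrite !cross_double !opprB !opprD !opprK.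
  by rewrite [LHS](AC ((2*2)*(2*2)) ((1*5)*(3*7)*(2*6)*(4*8)))%AC /= addNr addr0.
rewrite -[cdmul s v - _]opprB -opprD opprK.
suff -> : cdscal n lambda + (L - ((cross u t : cd R n) + (cross s v : cd R n))) =
    L + (cdmul (t : cd R n) u - cdmul (s : cd R n) v) by [].
rewrite !cdmul_imag cross_anti /cdscal scalerBl opprD opprK opprB.
by rewrite [LHS](AC (2*(1*2)) (3*((4*2)*(1*5))))%AC.
Qed.
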